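(* Let $X$ be a vector space over $\mathbb{R}$ or $\mathbb{C}$ and let $\rho : X \to [0,+\infty]$ be a convex modular satisfying the $\Delta_2$-condition. Then the modular space $X_\rho$, endowed with its topology $\tau$, is a normal topological space.
   Context: A modular on a vector space $X$ over $\mathbb{R}$ or $\mathbb{C}$ is a map $\rho : X \to [0,+\infty]$ such that for all $x,y \in X$: (i) $\rho(x) = 0$ if and only if $x = 0$; (ii) $\rho(-x) = \rho(x)$ in the real case, and $\rho(e^{it}x) = \rho(x)$ for all $t \in \mathbb{R}$ in the complex case; (iii) $\rho(\alpha x + \beta y) \le \rho(x) + \rho(y)$ whenever $\alpha, \beta \ge 0$ and $\alpha + \beta = 1$. The modular is convex if (iii) is replaced by $\rho(\alpha x + \beta y) \le \alpha\rho(x) + \beta\rho(y)$ whenever $\alpha,\beta \ge 0$, $\alpha+\beta = 1$. The associated modular space is $X_\rho = \{x \in X : \rho(\lambda x) \to 0 \text{ as } \lambda \to 0\}$, a vector subspace of $X$. $\Delta_2$-condition: for every sequence $(x_n)_{n \in \mathbb{N}}$ in $X_\rho$, if $\lim_{n\to\infty} \rho(x_n) = 0$ then $\lim_{n\to\infty} \rho(2x_n) = 0$. Topology: for $r > 0$ let $B_\rho(0,r) = \{x \in X_\rho : \rho(x) < r\}$ and let $\mathcal{B} = \{B_\rho(0,r) : r > 0\}$. The topology $\tau$ on $X_\rho$ is $\tau = \{G \subset X_\rho : \text{for every } x \in G \text{ there exists } V \in \mathcal{B} \text{ with } x + V \subset G\}$ (it contains $\emptyset$). *)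

(* Defs.v *)
From HB Require Import structures.
From mathcomp Require Import all_boot all_order all_algebra.
From mathcomp Require Import complex.
From mathcomp Require Import all_classical all_reals all_analysis.

Set Implicit Arguments.
Unset Strict Implicit.
Unset Printing Implicit Defensive.

Import Order.TTheory GRing.Theory Num.Theory.
Import numFieldNormedType.Exports.

Local Open Scope classical_set_scope.
Local Open Scope ring_scope.

(* Quantifying over k : scalar_kind and X : lmodType (scalars R k) amounts to
   "X is a vector space over the reals or over the complex numbers". *)
Variant scalar_kind := RealScalars | ComplexScalars.

Definition scalars (R : realType) (k : scalar_kind) : numFieldType :=
  match k with RealScalars => R | ComplexScalars => R[i] end.

Definition real_scalar (R : realType) (k : scalar_kind) :
    {rmorphism R -> scalars R k} :=
  match k with
  | RealScalars => idfun
  | ComplexScalars => real_complex R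
  end.

(* Complex (cos t) (sin t) is e^(it). *)
Definition phase_invariant (R : realType) (k : scalar_kind) :
    forall X : lmodType (scalars R k), (X -> \bar R) -> Prop :=
  match k with
  | RealScalars => fun X rho => forall x : X, rho (- x) = rho x
  | ComplexScalars => fun X rho =>
      forall (t : R) (x : X), rho (Complex (cos t) (sin t) *: x) = rho x
  end.

Section modulars.
Context (R : realType) (k : scalar_kind) (X : lmodType (scalars R k)).
Implicit Type rho : X -> \bar R.

Local Notation "a %:K" := (@real_scalar R k a) (at level 1, format "a %:K").

Record is_modular rho : Prop := IsModular {
  modular_ge0 : forall x, (0 <= rho x)%E;
  modular_eq0 : forall x, rho x = 0%E <-> x = 0;
  modular_phase : phase_invariant rho;
  modular_le : forall (x y : X) (a b : R), 0 <= a -> 0 <= b -> a + b = 1 ->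
    (rho (a%:K *: x + b%:K *: y)%R <= rho x + rho y)%E }.

(* The library convention 0 * +oo = 0 is harmless here: when a = 0 the
   inequality reads rho y <= 0 * rho x + rho y, which always holds. *)
Record is_convex_modular rho : Prop := IsConvexModular {
  convex_modular_ge0 : forall x, (0 <= rho x)%E;
  convex_modular_eq0 : forall x, rho x = 0%E <-> x = 0;
  convex_modular_phase : phase_invariant rho;
  convex_modular_le : forall (x y : X) (a b : R),
    0 <= a -> 0 <= b -> a + b = 1 ->
    (rho (a%:K *: x + b%:K *: y)%R <= a%:E * rho x + b%:E * rho y)%E }.

Lemma is_convex_modularW rho : is_convex_modular rho -> is_modular rho.
Proof.
case=> r0 req rph rc; split=> // x y a b a0 b0 ab.
apply: le_trans (rc x y a b a0 b0 ab) _.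
by apply: leeD; rewrite -[leRHS]mul1e lee_wpmul2r // lee_fin -ab
  ?lerDl ?lerDr.
Qed.

Record modular := Modular {
  modular_fun :> X -> \bar R;
  modularP : is_modular modular_fun }.

Record convex_modular := ConvexModular {
  convex_modular_fun : X -> \bar R;
  convex_modularP : is_convex_modular convex_modular_fun }.

Coercion modular_of_convex (rho : convex_modular) : modular :=
  Modular (is_convex_modularW (convex_modularP rho)).

(* The limit is taken along nonzero scalars l of the base field tending to 0. *)
Definition in_modular_space (rho : modular) : {pred X} :=
  mem [set x : X | rho (l *: x) @[l --> (0 : scalars R k)^'] --> (0%E : \bar R)].

Lemma in_modular_spaceP (rho : modular) (x : X) :
  x \in in_modular_space rho <->
  rho (l *: x) @[l --> (0 : scalars R k)^'] --> (0%E : \bar R).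
Proof. by split=> [/set_mem|/mem_set]. Qed.

Lemma modular0 (rho : modular) : rho 0 = 0%E.
Proof. exact/(modular_eq0 (modularP rho)). Qed.

Let dnbhs0_scale (c : scalars R k) : c != 0 ->
  c * l @[l --> (0 : scalars R k)^'] --> (0 : scalars R k)^'.
Proof.
move=> c0 A; rewrite /= !nbhs_simpl /= => A0.
have := @mulrl_continuous (scalars R k) c 0; rewrite /continuous_at mulr0.
move=> /(_ _ A0) H; rewrite /dnbhs /within /=.
apply: (@filterS _ (nbhs (0 : scalars R k)) _ _ _ _ H) => l /= h l0; apply: h.
by rewrite mulf_neq0.
Qed.

Lemma modular_space_submod_closed (rho : modular) :
  submod_closed (in_modular_space rho).
Proof.
have scl (c : scalars R k) x : c != 0 -> x \in in_modular_space rho ->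
    rho ((c * l) *: x) @[l --> (0 : scalars R k)^'] --> (0%E : \bar R).
  move=> c0 /in_modular_spaceP.
  exact: (@cvg_comp _ _ _ (fun l : scalars R k => c * l)
    (fun l => rho (l *: x)) _ _ _ (dnbhs0_scale c0)).
split.
  apply/in_modular_spaceP; rewrite [X in X @ _](_ : _ = cst 0%E).
    exact: cvg_cst.
  by apply/funext => l; rewrite scaler0 modular0.
move=> a x y xrho yrho; apply/in_modular_spaceP.
have x2 : rho ((2 * a * l) *: x) @[l --> (0 : scalars R k)^'] --> (0%E : \bar R).
  have [->|a0] := eqVneq a 0.
    rewrite [X in X @ _](_ : _ = cst 0%E); first exact: cvg_cst.
    by apply/funext => l; rewrite mulr0 mul0r scale0r modular0.
  by apply: scl => //; rewrite mulf_neq0// pnatr_eq0.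
have y2 := scl 2 y (ltac:(by rewrite pnatr_eq0)) yrho.
have xy2 : (rho ((2 * a * l) *: x) + rho ((2 * l) *: y))%E
    @[l --> (0 : scalars R k)^'] --> (0%E : \bar R).
  by rewrite -[X in _ --> X]adde0; apply: cvgeD.
apply: (squeeze_cvge _ (cvg_cst 0%E) xy2).
apply: nearW => l; apply/andP; split; first exact: (modular_ge0 (modularP rho)).
have h0 : 0 <= 2^-1 :> R by rewrite invr_ge0.
have h1 : 2^-1 + 2^-1 = 1 :> R by rewrite [RHS](splitr 1) mul1r.
apply: le_trans (modular_le (modularP rho) _ _ h0 h0 h1).
rewrite !scalerA fmorphV rmorph_nat !mulrA mulVf ?pnatr_eq0// !mul1r.
by rewrite scalerDr scalerA mulrC.
Qed.

HB.instance Definition _ (rho : modular) :=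
  GRing.isSubmodClosed.Build _ _ (in_modular_space rho)
    (modular_space_submod_closed rho).

Record modular_space (rho : modular) := ModularSpace {
  modular_space_val :> X;
  modular_space_valP : modular_space_val \in in_modular_space rho }.

HB.instance Definition _ (rho : modular) :=
  [isSub for @modular_space_val rho].
HB.instance Definition _ (rho : modular) :=
  [Choice of modular_space rho by <:].
HB.instance Definition _ (rho : modular) :=
  [SubChoice_isSubLmodule of modular_space rho by <:].

Section topology.
Variable rho : modular.
Implicit Types (x v : modular_space rho) (G : set (modular_space rho)).

Definition modular_ball (r : R) : set (modular_space rho) :=
  [set v | (rho (val v) < r%:E)%E].

Definition modular_open : set_system (modular_space rho) :=
  [set G | forall x, G x -> exists2 r : R, 0 < r &
    [set x + v | v in modular_ball r] `<=` G].

Let modular_openT : modular_open setT.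
Proof. by move=> x _; exists 1. Qed.

Let modular_openI : setI_closed modular_open.
Proof.
move=> A B oA oB x [/oA[r r0 rA] /oB[s s0 sB]].
exists (Num.min r s); first by rewrite lt_min r0.
move=> _ [v vrs <-]; split.
  by apply: rA; exists v => //; apply: lt_le_trans vrs _; rewrite lee_fin ge_min lexx.
by apply: sB; exists v => //; apply: lt_le_trans vrs _;
  rewrite lee_fin ge_min lexx orbT.
Qed.

Let modular_open_bigU (I : Type) (f : I -> set (modular_space rho)) :
  (forall i, modular_open (f i)) -> modular_open (\bigcup_i f i).
Proof.
move=> of_ x [i _ /of_[r r0 rf]]; exists r => // y /rf fy.
by exists i.
Qed.

HB.instance Definition _ := isOpenTopological.Build (modular_space rho)
  modular_openT modular_openI modular_open_bigU.

Lemma modular_openE : open = modular_open.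
Proof. by []. Qed.

End topology.

Definition Delta2 (rho : modular) : Prop :=
  forall u : nat -> X, (forall n, u n \in in_modular_space rho) ->
    rho (u n) @[n --> \oo] --> (0%E : \bar R) ->
    rho (2 *: u n) @[n --> \oo] --> (0%E : \bar R).

End modulars.

(* Main.v *)
Require Import Defs.
From mathcomp Require Import all_boot all_order all_algebra.
From mathcomp Require Import complex.
From mathcomp Require Import all_classical all_reals all_analysis.

Set Implicit Arguments.
Unset Strict Implicit.
Unset Printing Implicit Defensive.

Import Order.TTheory GRing.Theory Num.Theory.
Import numFieldNormedType.Exports.

Local Open Scope classical_set_scope.
Local Open Scope ring_scope.

(* The Delta2-condition provides, for each r > 0, some s > 0 such that
   B(0, s) + B(0, s) is contained in B(0, r); hence x + B(0, r), which need not
   be open, is a neighbourhood of x. Given A closed with a neighbourhood B, pick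
   for a in A a radius r with a + B(0, r) inside B, and for z outside B a radius
   r' with z + B(0, r') missing A. If s and s' are the associated radii, then
   a + B(0, s) and z + B(0, s') are disjoint: a common point would give
   z - a in B(0, r) when s' <= s, and a - z in B(0, r') otherwise. *)

Section modular_space_normal.
Context (R : realType) (k : scalar_kind) (X : lmodType (scalars R k)).
Implicit Type rho : modular X.

Lemma modularN rho (x : X) : rho (- x) = rho x.
Proof.
have := modular_phase (modularP rho); move: X rho x; case: k => /= Y rho x.
  exact.
(* In the complex case, invariance at [t = pi] suffices, since e^(i pi) = -1. *)
move=> /(_ pi x); rewrite cospi sinpi => <-; congr (_ _).
rewrite (_ : Complex _ _ = -1) ?scaleN1r//.
by apply/eqP; rewrite eq_complex /= oppr0 !eqxx.
Qed.

(** Holds because [x + y] is the midpoint of [2 *: x] and [2 *: y]; it stands in for the triangle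
    inequality. *)
Lemma modularD_le rho (x y : X) :
  (rho (x + y)%R <= rho (2 *: x) + rho (2 *: y))%E.
Proof.
have h0 : 0 <= 2^-1 :> R by rewrite invr_ge0.
have h1 : 2^-1 + 2^-1 = 1 :> R by rewrite [RHS](splitr 1) mul1r.
have := modular_le (modularP rho) (2 *: x) (2 *: y) h0 h0 h1.
by rewrite !scalerA fmorphV rmorph_nat mulVf ?pnatr_eq0// !scale1r.
Qed.

(** Epsilon-delta form of [Delta2]: if it failed at [r], some sequence in the modular space would
    satisfy [rho (u n) < 1/(n+1)] while [rho (2 *: u n)] stays at least [r]. *)
Lemma Delta2_uniform rho : Delta2 rho -> forall r : R, 0 < r ->
  exists2 s : R, 0 < s & forall x : X, x \in in_modular_space rho ->
    (rho x < s%:E -> rho (2 *: x) < r%:E)%E.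
Proof.
move=> D2 r r0; apply: contrapT => noS.
have /choice[u uP] : forall n : nat, exists x : X,
    [/\ x \in in_modular_space rho, (rho x < (n.+1%:R^-1)%:E)%E &
        ~ (rho (2 *: x) < r%:E)%E].
  move=> n; apply: contrapT => nox; apply: noS.
  exists n.+1%:R^-1; first by rewrite invr_gt0.
  by move=> x xX xn; apply: contrapT => xr; apply: nox; exists x.
have u0 : rho (u n) @[n --> \oo] --> (0%E : \bar R).
  apply: (@squeeze_cvge _ _ _ _ (cst 0%E) _ (fun n => (n.+1%:R^-1)%:E)).
  - apply: nearW => n; rewrite (modular_ge0 (modularP rho)) /=.
    by have [_ /ltW] := uP n.
  - exact: cvg_cst.
  - by apply: cvg_EFin; [exact: nearW|exact: cvg_harmonic].
have /(_ u0) u20 := D2 u (fun n => let: And3 p _ _ := uP n in p).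
have [N _ /(_ N (leqnn N)) uN] : \forall n \near \oo, (rho (2 *: u n) < r%:E)%E.
  by apply: (u20 [set y | (y < r%:E)%E]); apply: open_ereal_lt'; rewrite lte_fin.
by have [_ _] := uP N; apply.
Qed.

(** The factor 2 lost in [modularD_le] is absorbed by [Delta2_uniform] at radius [r / 2], one half
    for each summand. *)
Lemma modular_ballD rho : Delta2 rho -> forall r : R, 0 < r ->
  exists2 s : R, 0 < s & forall v w : modular_space rho,
    modular_ball s v -> modular_ball s w -> modular_ball r (v + w).
Proof.
move=> D2 r r0; have [s s0 sP] := Delta2_uniform D2 (divr_gt0 r0 (@ltr0Sn R 1)).
exists s => // v w vs ws; rewrite /modular_ball /=.
apply: le_lt_trans (modularD_le _ _ _) _.
by rewrite [r]splitr EFinD lteD// sP//; exact: modular_space_valP.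
Qed.

Lemma modular_ballN rho (r : R) (v : modular_space rho) :
  modular_ball r (- v) = modular_ball r v.
Proof. by rewrite /modular_ball /= modularN. Qed.

Lemma nbhs_modularP rho : Delta2 rho ->
  forall (x : modular_space rho) (W : set (modular_space rho)),
  nbhs x W <->
  exists2 r : R, 0 < r & forall v, modular_ball r v -> W (x + v).
Proof.
move=> D2 x W; split.
  rewrite nbhsE => -[G [oG Gx] GW]; have [r r0 rG] := oG x Gx.
  by exists r => // v vr; apply/GW/rG; exists v.
move=> [r r0 rW].
(* [I] is the candidate interior of [W]: it lies in [W] because balls contain 0, and it is open
   because a ball of radius [s] around [y] leaves room for a second one inside [y + B(0, t)]. *)
pose I := [set y : modular_space rho |
  exists2 r : R, 0 < r & forall v, modular_ball r v -> W (y + v)].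
have ball0 (t : R) : 0 < t -> modular_ball t (0 : modular_space rho).
  by move=> t0; rewrite /modular_ball /= modular0 lte_fin.
rewrite nbhsE; exists I; last first.
  by move=> y [t t0 tW]; rewrite -[y]addr0; apply/tW/ball0.
split; last by exists r.
move=> y [t t0 tW]; have [s s0 sP] := modular_ballD D2 t0.
exists s => // _ [v vs <-]; exists s => // w ws.
by rewrite -addrA; apply/tW/sP.
Qed.

Lemma Delta2_normal rho : Delta2 rho -> normal_space (modular_space rho).
Proof.
move=> D2 A clA B AB.
(* Choice needs total functions: [h] and, below, [f] take the dummy radius 0 where [0 < r] or [A a]
   fails. *)
have /choice[h hP] : forall r : R, exists s : R, 0 < r -> 0 < s /\
    forall v w : modular_space rho,
    modular_ball s v -> modular_ball s w -> modular_ball r (v + w).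
  move=> r; have [r0|] := pselect (0 < r); last by exists 0.
  by have [s s0 sP] := modular_ballD D2 r0; exists s.
have /choice[f fP] : forall a : modular_space rho, exists r : R, A a -> 0 < r /\
    forall v, modular_ball r v -> B (a + v).
  move=> a; have [/AB/(nbhs_modularP D2)[r r0 rB]|] := pselect (A a).
    by exists r.
  by exists 0.
(* Normality is proved in the form: [B] contains the closure of some neighbourhood of [A]. The
   witness is the union of the shrunken balls around the points of [A]. *)
exists [set y | exists2 a, A a & modular_ball (h (f a)) (y - a)].
  move=> a Aa; apply/(nbhs_modularP D2); have [/hP[s0 _] _] := fP a Aa.
  by exists (h (f a)) => // v vs; exists a => //; rewrite addrC addKr.
move=> z clz; apply: contrapT => nBz.
have nAz : ~ A z by move=> /AB/nbhs_singleton.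
have /(nbhs_modularP D2)[r r0 rA] : nbhs z (~` A).
  by apply: open_nbhs_nbhs; split => //; exact: closed_openC.
have [s0 hD] := hP r r0.
have /clz[y [[a Aa ya] yz]] :
    nbhs z [set y : modular_space rho | modular_ball (h r) (y - z)].
  by apply/(nbhs_modularP D2); exists (h r) => // v; rewrite /= addrC addKr.
have [/hP[_ hfD] fB] := fP a Aa.
have ball_le (s t : R) (v : modular_space rho) :
    s <= t -> modular_ball s v -> modular_ball t v.
  by move=> st /lt_le_trans; apply; rewrite lee_fin.
(* Both differences must lie in one common ball before they can be added, so the larger of the two
   radii is used. *)
have [le_s|/ltW le_s] := leP (h r) (h (f a)).
  apply: nBz; rewrite -[z](subrK a) addrC; apply: fB.
  have -> : z - a = - (y - z) + (y - a) by rewrite opprB addrA subrK.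
  by apply: hfD => //; rewrite modular_ballN; exact: ball_le yz.
apply: (rA (a - z)); last by rewrite addrC subrK.
have -> : a - z = - (y - a) + (y - z) by rewrite opprB addrA subrK.
by apply: hD => //; rewrite modular_ballN; exact: ball_le ya.
Qed.

End modular_space_normal.

Theorem mainTheorem6 (R : realType) (k : scalar_kind)
    (X : lmodType (scalars R k)) (rho : convex_modular X) :
  Delta2 rho -> normal_space (modular_space rho).
Proof. exact: Delta2_normal. Qed.
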